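(* Let $(U_n)_{n\ge 0}$ be a stationary variable length Markov chain (SVLMC) on $\mathcal L$ associated with a probabilized context tree $(\mathcal T,(q_c)_{c\in\mathcal C})$ over $\mathcal A=\{0,1\}$, with stationary (initial) probability measure $\pi$ on $\mathcal L$. Let $(X_n)_{n\ge 0}$ be the process of final letters of $(U_n)_{n\ge 0}$, let $I=[0,1]$, let $T:I\to I$ be the mapping associated with the SVLMC and let $\rho:I\to\mathcal A$ be the coding function. Then: (i) Lebesgue measure on $I$ is $T$-invariant, i.e. $|T^{-1}B|=|B|$ for every Borel set $B\subseteq I$. (ii) If $\xi$ is any uniformly distributed random variable on $I$, the processes $(X_n)_{n\ge 0}$ and $(Y_n)_{n\ge 0}:=(\rho(T^n\xi))_{n\ge 0}$ are symmetrically distributed: for every $N\ge 0$ and every word $w\in\mathcal A^{N+1}$, $$\mathbf P(X_0X_1\cdots X_N=w)=\mathbf P(Y_0Y_1\cdots Y_N=\overline w).$$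
   Context: **Words.** $\mathcal A=\{0,1\}$, $\mathbb N=\{0,1,2,\dots\}$; $\mathcal W=\bigcup_{n\ge0}\mathcal A^n$ is the set of finite words, $\emptyset$ the empty word, $|w|$ the length of $w$. $\mathcal L=\mathcal A^{-\mathbb N}$ is the set of left-infinite sequences $\cdots\alpha_{-1}\alpha_0$ and $\mathcal R=\mathcal A^{\mathbb N}$ the set of right-infinite sequences. $\overline{w}$ is the reversed word of $w\in\mathcal W$; for $s=\cdots\alpha_{-1}\alpha_0\in\mathcal L$, $\overline s=\alpha_0\alpha_{-1}\cdots\in\mathcal R$. For $w\in\mathcal W$, $\mathcal Lw$ is the set of $s\in\mathcal L$ having $w$ as a suffix; $\mathcal L$ carries the $\sigma$-algebra generated by these cylinders. **Context trees.** A tree is a set $\mathcal T\subseteq\mathcal W$ containing $\emptyset$ and closed under taking prefixes. Its finite leaves are the $u\in\mathcal T$ with $u0,u1\notin\mathcal T$; its infinite leaves are the $u\in\mathcal R$ all of whose finite prefixes are in $\mathcal T$. Internal nodes are the elements of $\mathcal T$ that are not finite leaves. $\mathcal T$ is saturated if every internal node $w$ satisfies $w0,w1\in\mathcal T$. A context tree is a saturated tree whose set $\mathcal C$ of all (finite and infinite) leaves is at most countable; leaves are called contexts. A probabilized context tree is a pair $(\mathcal T,(q_c)_{c\in\mathcal C})$ with each $q_c$ a probability measure on $\mathcal A$. **VLMC.** For $s\in\mathcal L$, $\mathrm{pref}(s)$ is the unique context $c\in\mathcal C$ that is a prefix of $\overline s$ (or equals $\overline s$ when infinite). The associated VLMC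 is the $\mathcal L$-valued Markov chain $(U_n)_{n\ge0}$ with transitions $\mathbf P(U_{n+1}=U_n\alpha\mid U_n)=q_{\mathrm{pref}(U_n)}(\alpha)$, $\alpha\in\mathcal A$. The rightmost letter of $U_n$ is $X_n$. It is an SVLMC when $U_0$ is distributed according to a stationary probability measure $\pi$. Notation: $\pi(w):=\pi(\mathcal Lw)$. **Subdivision.** $|J|$ denotes the Lebesgue measure of $J$. For $w\in\mathcal W$, put $a_w=\sum\pi(\overline v)$, the sum being over words $v$ with $|v|=|w|$ and $v<w$ in the alphabetical order, and let $I_w=\,]a_w,a_w+\pi(\overline w)]$, except that $I_{0^n}=[0,\pi(0^n)]$ for $n\ge0$. Thus $|I_w|=\pi(\overline w)$ and $I_w$ is the disjoint union of $I_{w0}$ and $I_{w1}$. For $r\in\mathcal R$, $I_r$ is the intersection of the $I_w$ over finite prefixes $w$ of $r$. **Coding function.** $\rho:I\to\mathcal A$ is equal to $\alpha$ on $I_\alpha$, $\alpha\in\mathcal A$. **Mapping $T$.** $T:I\to I$ is the unique function that is left continuous on $]0,1]$, with $T(0)=\lim_{x\to0^+}T(x)$, such that for every $\alpha\in\mathcal A$ and $c\in\mathcal C$ with $|I_{\alpha c}|>0$, the restriction of $T$ to the interior of $I_{\alpha c}$ is the increasing affine bijection onto the interior of $I_c$. *)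

(* Defs.v *)
From mathcomp Require Import all_boot all_order all_algebra.
From mathcomp Require Import all_classical all_reals all_analysis measurable_realfun.

Set Implicit Arguments.
Unset Strict Implicit.
Unset Printing Implicit Defensive.

Import Order.TTheory GRing.Theory Num.Theory.
Import numFieldNormedType.Exports.

Local Open Scope classical_set_scope.
Local Open Scope ring_scope.

(* The alphabet {0, 1} is [bool], with 0 = [false] and 1 = [true]. *)
Definition word := seq bool.

Definition right_seq := nat -> bool.

(* [s : left_seq] encodes ... s_2 s_1 s_0: the letter alpha_{-k} is [s k], so
   that the rightmost letter is [s 0] and reversal is the identity on the
   encodings. *)
Definition left_seq := nat -> bool.
Definition reverse (s : left_seq) : right_seq := s.

Definition prefix_inf (u : word) (r : right_seq) : Prop :=
  mkseq r (size u) = u.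

(* [prefix_inf (rev w) (reverse s)] says that w is a suffix of s. *)
Definition cylinder (w : word) : set left_seq :=
  [set s | prefix_inf (rev w) (reverse s)].

Definition left_space := g_sigma_algebraType (range cylinder).

Definition append_letter (s : left_space) (a : bool) : left_space :=
  fun k => if k is k'.+1 then s k' else a.

Definition is_tree (T : set word) : Prop :=
  T [::] /\ forall u v : word, prefix u v -> T v -> T u.

Definition finite_leaf (T : set word) (u : word) : Prop :=
  T u /\ forall a : bool, ~ T (rcons u a).

Definition infinite_leaf (T : set word) (r : right_seq) : Prop :=
  forall u : word, prefix_inf u r -> T u.

Definition internal_node (T : set word) (w : word) : Prop :=
  T w /\ ~ finite_leaf T w.

Definition saturated (T : set word) : Prop :=
  forall w : word, internal_node T w -> forall a : bool, T (rcons w a).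

(* [inl u] is a finite word, [inr r] a right-infinite one. *)
Definition fi_word : Type := (word + right_seq)%type.

Definition contexts (T : set word) : set fi_word :=
  [set c | match c with
           | inl u => finite_leaf T u
           | inr r => infinite_leaf T r
           end].

Definition context_tree (T : set word) : Prop :=
  [/\ is_tree T, saturated T & countable (contexts T)].

Definition fi_prefix (c : fi_word) (r : right_seq) : Prop :=
  match c with
  | inl u => prefix_inf u r
  | inr r' => r' = r
  end.

Definition fi_cons (a : bool) (c : fi_word) : fi_word :=
  match c with
  | inl u => inl (a :: u)
  | inr r => inr (fun n => if n is m.+1 then r m else a)
  end.

(* The default value [inl [::]] is irrelevant: when T is a context tree, exactly
   one context is a prefix of the reversal of s. *)
Definition pref (T : set word) (s : left_space) : fi_word :=
  xget (inl [::] : fi_word) [set c | contexts T c /\ fi_prefix c (reverse s)].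

(* [f] is a version of the conditional probability of the event [E] given the
   sub-sigma-algebra [F]. *)
Definition cond_prob_version (R : realType) (d : measure_display)
    (Omega : measurableType d) (P : probability Omega R)
    (F : set (set Omega)) (E : set Omega) (f : Omega -> \bar R) : Prop :=
  preimage_set_system setT f measurable `<=` F /\
  forall A, F A -> (P (E `&` A) = \int[P]_(o in A) f o)%E.

Definition history (R : realType) (d : measure_display)
    (Omega : measurableType d) (P : probability Omega R)
    (U : nat -> {RV P >-> left_space}) (n : nat) : set (set Omega) :=
  <<s \bigcup_(k in `I_n.+1) preimage_set_system setT (U k) measurable >>.

(* Only the values of [q] on [contexts T] matter.  Conditioning on the whole past
   U_0, ..., U_n expresses the Markov property together with the transition
   probabilities given U_n. *)
Definition vlmc (R : realType) (T : set word)
    (q : fi_word -> probability bool R) (d : measure_display)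
    (Omega : measurableType d) (P : probability Omega R)
    (U : nat -> {RV P >-> left_space}) : Prop :=
  forall (n : nat) (a : bool),
    cond_prob_version P (history U n)
      [set o | U n.+1 o = append_letter (U n o) a]
      (fun o => q (pref T (U n o)) [set a]).

Definition vlmc_kernel (R : realType) (T : set word)
    (q : fi_word -> probability bool R) (s : left_space)
    (A : set left_space) : \bar R :=
  (\sum_(a : bool) q (pref T s) [set a] * \d_(append_letter s a) A)%E.

Definition stationary (R : realType) (T : set word)
    (q : fi_word -> probability bool R)
    (pi : probability left_space R) : Prop :=
  forall A : set left_space, measurable A ->
    (\int[pi]_s vlmc_kernel T q s A = pi A)%E.

Definition svlmc (R : realType) (T : set word)
    (q : fi_word -> probability bool R) (pi : probability left_space R)
    (d : measure_display) (Omega : measurableType d)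
    (P : probability Omega R) (U : nat -> {RV P >-> left_space}) : Prop :=
  [/\ vlmc T q U, stationary T q pi &
      forall A : set left_space, measurable A ->
        distribution P (U 0%N) A = pi A].

Definition final_letter (R : realType) (d : measure_display)
    (Omega : measurableType d) (P : probability Omega R)
    (U : nat -> {RV P >-> left_space}) (n : nat) (o : Omega) : bool :=
  (U n o : left_seq) 0%N.

Section Subdivision.
Variables (R : realType) (pi : probability left_space R).

Definition word_prob (w : word) : R := fine (pi (cylinder w)).

Definition left_end (w : word) : R :=
  \sum_(v : (size w).-tuple bool | (tval v < w :> seqlexi bool)%O)
    word_prob (rev v).

Definition Iword (w : word) : set R :=
  if w == nseq (size w) false then `[0, word_prob w]%classic
  else `]left_end w, left_end w + word_prob (rev w)]%classic.

Definition Ifi (c : fi_word) : set R :=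
  match c with
  | inl u => Iword u
  | inr r => \bigcap_(u in [set u | prefix_inf u r]) Iword u
  end.

Definition coding_function (rho : R -> bool) : Prop :=
  forall (a : bool) (x : R), Iword [:: a] x -> rho x = a.

(* A self-map of I = [0, 1] is represented by a function on R preserving I; its
   values outside I are irrelevant.  Interiors are taken in R. *)
Record vlmc_mapping (tree : set word) (T : R -> R) : Prop := VlmcMapping {
  vlmc_mapping_fun : set_fun `[0, 1] `[0, 1] T ;
  vlmc_mapping_left : forall x : R, 0 < x <= 1 -> T y @[y --> x^'-] --> T x ;
  vlmc_mapping0 : T y @[y --> 0^'+] --> T 0 ;
  vlmc_mapping_affine : forall (a : bool) (c : fi_word), contexts tree c ->
    (0 < lebesgue_measure (Ifi (fi_cons a c)))%E ->
    (exists k l : R, 0 < k /\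
       forall x, (Ifi (fi_cons a c))° x -> T x = k * x + l) /\
    set_bij (Ifi (fi_cons a c))° (Ifi c)° T }.

End Subdivision.

(* Main.v *)
Require Import Defs.
From mathcomp Require Import all_boot all_order all_algebra.
From mathcomp Require Import all_classical all_reals all_analysis measurable_realfun.
From mathcomp Require Import ring lra.

(** The reversal of a left-infinite sequence turns words read from the right
    end into prefixes: [starts_with w] is the set of the sequences whose
    reversal begins with w, and |I_w| is its mass.  The intervals I_w of the
    words of a given length lie on the line in the alphabetical order.

    Everything rests on one consequence of stationarity.  If all the sequences
    of a set A have the same context c, then appending the letter a to all of
    them multiplies the mass of A by q_c(a) ([stationary_append_set]).

    Invariance.  Taking for A the set of all the sequences with context c gives
    |I_ac| = q_c(a) |I_c|, so T has slope 1 / q_c(a) on I_ac when this length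
    is positive, and in all cases a part B of I_c is pulled back inside I_ac to
    a set of measure q_c(a) |B|.  The sum over the two letters is |B|.  Every
    sequence has exactly one context, and there are countably many contexts, so
    the lengths of the I_c add up to 1, and so do those of the I_ac: both
    families exhaust [0, 1] up to a null set, also after each interval is
    replaced by its interior.  Summing over c yields |T^-1 B| = |B|
    ([T_preserves_lebesgue]).

    Symmetry.  Taking for A the sequences with context c that come before a
    word in the alphabetical order shows that the endpoints of the intervals
    I_v inside I_c and of the intervals I_av inside I_ac correspond to each
    other under T.  Hence T x is in I_v if and only if x is in I_av, for x in
    the interior of I_ac ([T_shifts_Iword]).  By invariance, almost every orbit
    stays in these interiors, and such a point has an itinerary starting with v
    if and only if it lies in I_v; this has probability |I_v|
    ([lebesgue_measure_itinerary]).  As for the chain, U_n has law pi for all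
    n, and almost surely each U_(n+1) is U_n with a letter appended.  So
    X_0 ... X_N is almost surely the suffix of U_N of length N + 1, which
    equals w with probability pi (L w) = |I_v| for v the reversal of w
    ([final_letters_prob]). *)

Set Implicit Arguments.
Unset Strict Implicit.
Unset Printing Implicit Defensive.

Import Order.TTheory GRing.Theory Num.Theory.
Import numFieldNormedType.Exports.

Local Open Scope classical_set_scope.
Local Open Scope ring_scope.

(** * Sequences read backwards *)

Definition past (s : left_space) (n : nat) : word := mkseq (reverse s) n.
Arguments past : simpl never.

Lemma size_past s n : size (past s n) = n.
Proof. exact: size_mkseq. Qed.

Lemma nth_past s n k : (k < n)%N -> nth false (past s n) k = (s : left_seq) k.
Proof. exact: nth_mkseq. Qed.

Lemma take_past s m n : (m <= n)%N -> take m (past s n) = past s m.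
Proof. by move=> mn; rewrite /past /mkseq -map_take take_iota (minn_idPl mn). Qed.

Lemma past_append s a n : past (append_letter s a) n.+1 = a :: past s n.
Proof. by rewrite /past /mkseq/= (iotaDl 1 0) -map_comp. Qed.

Definition shift (s : left_space) : left_space := fun n => (s : left_seq) n.+1.

Lemma append_shift s : append_letter (shift s) ((s : left_seq) 0%N) = s.
Proof. by apply/funext => -[|k]. Qed.

Lemma past_shift s n : past s n.+1 = (s : left_seq) 0%N :: past (shift s) n.
Proof. by rewrite -{1}(append_shift s) past_append. Qed.

Lemma past_cat s m n : past s (m + n) = past s m ++ past (iter m shift s) n.
Proof.
elim: m s => [|m ih] s; first by rewrite add0n.
by rewrite addSn !past_shift ih iterSr.
Qed.

(** Cylinders separate points; equalities between sequences are reduced in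
    this way to countably many measurable conditions. *)
Lemma past_inj s t : (forall n, past s n = past t n) -> s = t.
Proof.
move=> st; apply/funext => k.
by rewrite -(nth_past s (ltnSn k)) st nth_past.
Qed.

Definition starts_with (w : word) : set left_space :=
  [set s | past s (size w) = w].

Definition starts_below (w : word) : set left_space :=
  [set s | (past s (size w) < w :> seqlexi bool)%O].

Lemma cylinder_rev w : cylinder (rev w) = starts_with w.
Proof. by rewrite /cylinder revK. Qed.

Lemma starts_with_nil : starts_with [::] = setT.
Proof. by apply/seteqP; split. Qed.

Lemma measurable_starts_with w : measurable (starts_with w).
Proof.
by rewrite -cylinder_rev; apply: sub_sigma_algebra; exists (rev w).
Qed.

(** A condition on finitely many letters is a finite union of cylinders, hence
    measurable: this covers all the sets of sequences below, in particular the
    initial segments of the alphabetical order. *)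
Lemma past_eventE n (A : set word) :
  [set s | A (past s n)] =
  \bigcup_(w in [set w : n.-tuple bool | A w]) starts_with w.
Proof.
apply/seteqP; split=> s /=.
  by move=> As; exists (Tuple (introT eqP (size_past s n)));
    rewrite /starts_with/= ?size_past.
by case=> w Aw; rewrite /starts_with/= size_tuple => ->.
Qed.

Lemma past_event_measurable n (A : set word) :
  measurable [set s : left_space | A (past s n)].
Proof.
rewrite past_eventE; apply: fin_bigcup_measurable => //.
by move=> w _; exact: measurable_starts_with.
Qed.

Lemma measurable_fun_past d (X : measurableType d) (f : X -> left_space) :
  (forall n (A : set word), measurable [set x | A (past (f x) n)]) ->
  measurable_fun setT f.
Proof.
move=> mf; apply: (@measurability _ _ X left_space setT f (range cylinder) erefl).
move=> _ [_ [w _ <-] <-]; rewrite setTI -(revK w) cylinder_rev.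
exact: (mf _ [set v | v = _]).
Qed.

Lemma measurable_append_letter a :
  measurable_fun setT (fun s : left_space => append_letter s a : left_space).
Proof.
apply: measurable_fun_past => -[|n] A; first exact: (past_event_measurable 0).
rewrite [X in measurable X](_ : _ = [set s | [set w | A (a :: w)] (past s n)]).
  exact: past_event_measurable.
by apply/seteqP; split=> s /=; rewrite past_append.
Qed.

Lemma measurable_shift : measurable_fun setT shift.
Proof.
apply: measurable_fun_past => n A.
rewrite [X in measurable X](_ : _ =
  [set s | [set w | A (behead w)] (past s n.+1)]).
  exact: past_event_measurable.
by apply/seteqP; split=> s; rewrite /mkset past_shift.
Qed.

Lemma measurable_seq1 (s : left_space) : measurable [set s].
Proof.
rewrite (_ : [set s] = \bigcap_n starts_with (past s n)).
  by apply: bigcapT_measurable => n; exact: measurable_starts_with.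
apply/seteqP; split=> [_ -> n _|t st]; rewrite /starts_with/= ?size_past//.
by apply: past_inj => n; have := st n I; rewrite /starts_with/= size_past.
Qed.

Lemma measurable_first_letter (a : bool) :
  measurable [set s : left_space | (s : left_seq) 0%N = a].
Proof.
rewrite [X in measurable X](_ : _ = [set s | [set w | w = [:: a]] (past s 1)]).
  exact: past_event_measurable.
by apply/seteqP; split=> s; rewrite /mkset past_shift; [move=> ->|case].
Qed.

Definition append_set (a : bool) (A : set left_space) : set left_space :=
  [set s | (s : left_seq) 0%N = a /\ A (shift s)].

Lemma measurable_append_set a A :
  measurable A -> measurable (append_set a A).
Proof.
move=> mA; apply: measurableI; first exact: measurable_first_letter.
by rewrite -[X in measurable X]setTI; exact: measurable_shift.
Qed.

Lemma append_set_starts a w :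
  append_set a (starts_with w) = starts_with (a :: w).
Proof.
apply/seteqP; split=> s; rewrite /append_set /starts_with/= past_shift.
  by move=> [-> ->].
by case.
Qed.

(** * The subdivision of the unit interval *)

(** Alphabetical comparison of words of equal length splits along any common
    cut, which is why I_(c z) sits inside I_c as z sits among the words of its
    length. *)
Lemma ltxi_cat (x c y z : word) : size x = size c ->
  (x ++ y < c ++ z :> seqlexi bool)%O =
  (x < c :> seqlexi bool)%O || (x == c) && (y < z :> seqlexi bool)%O.
Proof.
elim: x c => [|a x ih] [|b c]//= [/ih{}ih].
rewrite [LHS]ltxi_cons ih [X in _ = X || _]ltxi_cons eqseq_cons.
by case: a b => [] [] /=.
Qed.

Section subdivision.
Variables (R : realType) (pi : probability left_space R).
Implicit Types (w c z u v : word) (x y : R).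

Definition mass (A : set left_space) : R := fine (pi A).

Lemma massE A : measurable A -> (mass A)%:E = pi A.
Proof. by move=> mA; rewrite fineK// fin_num_measure. Qed.

Lemma mass_ge0 A : 0 <= mass A.
Proof. exact: fine_ge0. Qed.

Lemma le_mass A B : measurable A -> measurable B -> A `<=` B ->
  mass A <= mass B.
Proof. by move=> mA mB AB; rewrite -lee_fin !massE// le_measure// inE. Qed.

Lemma mass_setT : mass setT = 1.
Proof. by rewrite /mass probability_setT. Qed.

Lemma massU A B : measurable A -> measurable B -> A `&` B = set0 ->
  mass (A `|` B) = mass A + mass B.
Proof.
move=> mA mB AB; apply: EFin_inj.
by rewrite EFinD !massE ?measureU//; exact: measurableU.
Qed.

Lemma measurable_starts_below w : measurable (starts_below w).
Proof.
exact: (past_event_measurable _ [set v | (v < w :> seqlexi bool)%O]).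
Qed.

Lemma word_prob_rev w : word_prob pi (rev w) = mass (starts_with w).
Proof. by rewrite /word_prob cylinder_rev. Qed.

Lemma trivIset_starts_with n (D : set (n.-tuple bool)) :
  trivIset D (fun w : n.-tuple bool => starts_with w).
Proof.
move=> v w _ _ [s []]; rewrite /starts_with/= !size_tuple => -> vw.
exact: val_inj.
Qed.

(** The sum that defines a_w is the mass of one set of sequences, an initial
    segment of the alphabetical order; comparisons between endpoints become
    inclusions between sets. *)
Lemma left_endE w : left_end pi w = mass (starts_below w).
Proof.
rewrite /left_end; under eq_bigr do rewrite word_prob_rev.
rewrite /mass sum_fine; last first.
  by move=> v _; rewrite fin_num_measure//; exact: measurable_starts_with.
congr fine; rewrite /starts_below.
rewrite (past_eventE _ [set v | (v < w :> seqlexi bool)%O]).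
rewrite measure_fin_bigcup//=; last 2 first.
- exact: trivIset_starts_with.
- by move=> v _; exact: measurable_starts_with.
rewrite -big_filter fsbig_seq ?filter_uniq ?index_enum_uniq//.
rewrite (_ : [set` _] = [set v : (size w).-tuple bool |
  (tval v < w :> seqlexi bool)%O])//.
by apply/seteqP; split=> v /=; rewrite mem_filter mem_index_enum andbT.
Qed.

Lemma left_end_ge0 w : 0 <= left_end pi w.
Proof. by rewrite left_endE mass_ge0. Qed.

Lemma starts_below_disj w : starts_below w `&` starts_with w = set0.
Proof.
apply/seteqP; split=> // s []; rewrite /starts_below /starts_with/= => + sw.
by rewrite sw ltxx.
Qed.

Lemma right_endE w : left_end pi w + mass (starts_with w) =
  mass (starts_below w `|` starts_with w).
Proof.
rewrite massU -?left_endE//.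
- exact: measurable_starts_below.
- exact: measurable_starts_with.
- exact: starts_below_disj.
Qed.

Lemma measurable_starts_le w :
  measurable (starts_below w `|` starts_with w).
Proof.
apply: measurableU; first exact: measurable_starts_below.
exact: measurable_starts_with.
Qed.

Lemma right_end_le_left_end u v : size u = size v ->
  (u < v :> seqlexi bool)%O ->
  left_end pi u + mass (starts_with u) <= left_end pi v.
Proof.
move=> uv lt_uv; rewrite right_endE left_endE le_mass//.
- exact: measurable_starts_le.
- exact: measurable_starts_below.
move=> s; rewrite /starts_below /starts_with/= uv.
by case=> [/lt_trans|->//]; apply.
Qed.

(** The part of the cylinder of c to the left of I_(c z): its mass is the
    distance between the left endpoints of I_c and I_(c z). *)
Definition starts_with_below c z : set left_space :=
  starts_with c `&` (iter (size c) shift @^-1` starts_below z).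

Lemma measurable_iter_shift n : measurable_fun setT (iter n shift).
Proof.
elim: n => [|n ih]; first exact: measurable_id.
exact: measurableT_comp measurable_shift ih.
Qed.

Lemma starts_with_cat c z : starts_with (c ++ z) =
  starts_with c `&` (iter (size c) shift @^-1` starts_with z).
Proof.
apply/seteqP; split=> s; rewrite /starts_with/= size_cat past_cat.
  by move=> /eqP; rewrite eqseq_cat ?size_past// => /andP[/eqP-> /eqP->].
by case=> -> ->.
Qed.

Lemma starts_with_cat_sub c z : starts_with (c ++ z) `<=` starts_with c.
Proof. by rewrite starts_with_cat => s []. Qed.

Lemma measurable_starts_with_below c z : measurable (starts_with_below c z).
Proof.
apply: measurableI; first exact: measurable_starts_with.
rewrite -[X in measurable X]setTI; apply: measurable_iter_shift => //.
exact: measurable_starts_below.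
Qed.

Lemma starts_below_cat c z :
  starts_below (c ++ z) = starts_below c `|` starts_with_below c z.
Proof.
apply/seteqP; split=> s; rewrite /starts_below /starts_with_below /starts_with/=;
  rewrite size_cat past_cat ltxi_cat ?size_past//.
- by move=> /orP[->|/andP[/eqP -> zs]]; [left|right].
- by move=> [->//|[/eqP -> zs]]; rewrite [X in _ || X]zs orbT.
Qed.

Lemma left_end_cat c z :
  left_end pi (c ++ z) = left_end pi c + mass (starts_with_below c z).
Proof.
rewrite !left_endE starts_below_cat massU//.
- exact: measurable_starts_below.
- exact: measurable_starts_with_below.
- by rewrite setIA starts_below_disj set0I.
Qed.

Lemma left_end_le_cat c z : left_end pi c <= left_end pi (c ++ z).
Proof. by rewrite left_end_cat lerDl mass_ge0. Qed.

Lemma right_end_cat_le c z :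
  left_end pi (c ++ z) + mass (starts_with (c ++ z)) <=
  left_end pi c + mass (starts_with c).
Proof.
rewrite left_end_cat -addrA lerD2l -massU.
- rewrite le_mass//.
  + apply: measurableU; last exact: measurable_starts_with.
    exact: measurable_starts_with_below.
  + exact: measurable_starts_with.
  + by move=> s [[]//|]; exact: starts_with_cat_sub.
- exact: measurable_starts_with_below.
- exact: measurable_starts_with.
apply/seteqP; split=> // s; rewrite starts_with_cat => -[[_ sz] [_ /= zs]].
by have : (starts_below z `&` starts_with z) (iter (size c) shift s);
   [split|rewrite starts_below_disj].
Qed.

Lemma left_end_nseq0 n : left_end pi (nseq n false) = 0.
Proof.
rewrite left_endE (_ : starts_below _ = set0) ?/mass ?measure0//.
apply/seteqP; split=> // s; rewrite /starts_below/= size_nseq.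
elim: n s => [|n ih] s //; rewrite past_shift ltxi_cons.
by case: (_ 0%N) => //=; exact: ih.
Qed.

Lemma Iword_nseq0E w : w = nseq (size w) false ->
  Iword pi w = `[0, mass (starts_with w)]%classic /\ left_end pi w = 0.
Proof.
move=> wE; split; last by rewrite wE left_end_nseq0.
by rewrite /Iword -wE eqxx -word_prob_rev wE rev_nseq.
Qed.

Lemma Iword_neq0E w : w <> nseq (size w) false -> Iword pi w =
  `]left_end pi w, left_end pi w + mass (starts_with w)]%classic.
Proof. by move=> /eqP/negbTE wE; rewrite /Iword wE word_prob_rev. Qed.

(** Away from 0 the closed left end of I_(0^n) does not matter, and all the
    intervals are described by the same formula. *)
Lemma Iword_gt0 w x : 0 < x ->
  Iword pi w x <-> left_end pi w < x <= left_end pi w + mass (starts_with w).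
Proof.
move=> x0; have [/Iword_nseq0E[-> ->]|/Iword_neq0E ->] := pselect (w = nseq (size w) false).
  by rewrite /= in_itv/= add0r x0 (ltW x0).
by rewrite /= in_itv.
Qed.

Lemma Iword_ge0 w x : Iword pi w x -> 0 <= x.
Proof.
rewrite /Iword; case: ifPn => _ /=; rewrite in_itv/= => /andP[]// + _.
by move=> /ltW; apply: le_trans; exact: left_end_ge0.
Qed.

Lemma Iword0 w : Iword pi w 0 <-> w = nseq (size w) false.
Proof.
rewrite /Iword; case: ifPn => [/eqP wE|/eqP wE] /=; rewrite in_itv/=.
  by rewrite lexx mass_ge0.
by rewrite ltNge left_end_ge0.
Qed.

Lemma nseq0_cat c z : c ++ z = nseq (size (c ++ z)) false ->
  c = nseq (size c) false.
Proof.
rewrite size_cat nseqD => /eqP.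
by rewrite eqseq_cat ?size_nseq// => /andP[/eqP].
Qed.

Lemma Iword_cat_sub c z : Iword pi (c ++ z) `<=` Iword pi c.
Proof.
move=> x xcz; have := Iword_ge0 xcz; rewrite le_eqVlt => /predU1P[x0|x0].
  by move: xcz; rewrite -x0 !Iword0; exact: nseq0_cat.
move: xcz; rewrite !Iword_gt0// => /andP[lx xr]; apply/andP; split.
  exact: le_lt_trans (left_end_le_cat _ _) lx.
exact: le_trans xr (right_end_cat_le _ _).
Qed.

Lemma Iword_disj u v : size u = size v -> u != v ->
  Iword pi u `&` Iword pi v = set0.
Proof.
move=> uv neq_uv; apply/seteqP; split=> // x [].
wlog lt_uv : u v uv neq_uv / (u < v :> seqlexi bool)%O.
  move=> h xu xv; have /orP[lt_uv|lt_vu] := @lt_total _ (seqlexi bool) u v neq_uv.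
    exact: (h u v).
  by apply: (h v u) => //; rewrite eq_sym.
move=> xu; have := Iword_ge0 xu; rewrite le_eqVlt => /predU1P[x0|x0].
  move: xu; rewrite -x0 !Iword0 => uE vE.
  by move: neq_uv; rewrite uE vE uv eqxx.
move: xu; rewrite !Iword_gt0// => /andP[_ xu] /andP[+ _].
by rewrite ltNge (le_trans xu)// right_end_le_left_end.
Qed.

Lemma interior_Iword w :
  (Iword pi w)° = `]left_end pi w, left_end pi w + mass (starts_with w)[%classic.
Proof.
have [/Iword_nseq0E[-> ->]|/Iword_neq0E ->] := pselect (w = nseq (size w) false).
  by rewrite interior_itv add0r.
by rewrite interior_itv.
Qed.

Lemma is_interval_Iword w : is_interval (Iword pi w).
Proof. by rewrite /Iword; case: ifPn => _; exact: interval_is_interval. Qed.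

Lemma measurable_Iword w : measurable (Iword pi w).
Proof. by rewrite /Iword; case: ifPn => _; exact: measurable_itv. Qed.

Lemma lebesgue_measure_Iword w :
  lebesgue_measure (Iword pi w) = pi (starts_with w).
Proof.
rewrite -massE; last exact: measurable_starts_with.
have m0 := mass_ge0 (starts_with w).
have [/Iword_nseq0E[-> _]|/Iword_neq0E ->] := pselect (w = nseq (size w) false).
  rewrite lebesgue_measure_itv/= lte_fin sube0; case: ltP => // m0'.
  by congr EFin; apply/le_anti/andP.
rewrite lebesgue_measure_itv/= lte_fin ltrDl -EFinB addrAC subrr add0r.
by case: ltP => // m0'; congr EFin; apply/le_anti/andP.
Qed.

Lemma Iword_nil : Iword pi [::] = `[0, 1]%classic.
Proof.
have [-> _] := @Iword_nseq0E [::] erefl.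
by rewrite starts_with_nil mass_setT.
Qed.

Lemma Iword_sub01 w : Iword pi w `<=` `[0, 1].
Proof. by rewrite -Iword_nil; exact: (@Iword_cat_sub [::]). Qed.

End subdivision.

(** * Contexts and stationarity *)

Definition fi_word_prefix (w : word) (c : fi_word) : Prop :=
  match c with
  | inl u => prefix w u
  | inr r => prefix_inf w r
  end.

Definition starts_with_fi (c : fi_word) : set left_space :=
  [set s | fi_prefix c (reverse s)].

Lemma starts_with_fi_inl u : starts_with_fi (inl u) = starts_with u.
Proof. by []. Qed.

Lemma starts_with_fi_inr r : starts_with_fi (inr r) = [set (r : left_space)].
Proof. by apply/seteqP; split=> s /=; rewrite /starts_with_fi/= => ->. Qed.

Lemma measurable_starts_with_fi c : measurable (starts_with_fi c).
Proof.
case: c => [u|r]; first exact: measurable_starts_with.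
by rewrite starts_with_fi_inr; exact: measurable_seq1.
Qed.

Lemma starts_with_fi_sub w c :
  fi_word_prefix w c -> starts_with_fi c `<=` starts_with w.
Proof.
case: c => [u /= /prefixP[z ->]|r /= wr]; first exact: starts_with_cat_sub.
by rewrite starts_with_fi_inr => _ ->.
Qed.

Lemma fi_word_prefix_cons a w c :
  fi_word_prefix w c -> fi_word_prefix (a :: w) (fi_cons a c).
Proof.
case: c => [u|r] /=; first by rewrite eqxx.
rewrite /prefix_inf => {2}<-; exact: (past_append (r : left_space) a (size w)).
Qed.

Lemma append_set_starts_with_fi a c :
  append_set a (starts_with_fi c) = starts_with_fi (fi_cons a c).
Proof.
case: c => [u|r]; first by rewrite !starts_with_fi_inl append_set_starts.
rewrite !starts_with_fi_inr; apply/seteqP; split=> s /=.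
  by case=> s0 sr; rewrite -(append_shift s) s0 sr.
by move=> ->.
Qed.

(** Incompatible words have disjoint cylinders and disjoint intervals; two
    finite or infinite words neither of which is a prefix of the other have
    prefixes of this kind. *)
Definition incompatible (w w' : word) : Prop := size w = size w' /\ w != w'.

Lemma fi_word_cases (v : word) (c : fi_word) :
  [\/ fi_word_prefix v c,
      exists u z, c = inl u /\ v = u ++ z |
      exists w w', [/\ incompatible w w', fi_word_prefix w c & prefix w' v] ].
Proof.
case: c => [u|r] /=.
  have [|vu] := boolP (prefix v u); first by constructor 1.
  have [|uv] := boolP (prefix u v).
    by move=> /prefixP[z ->]; constructor 2; exists u, z.
  constructor 3; pose n := minn (size u) (size v).
  exists (take n u), (take n v); split; [split| |]; rewrite ?prefix_take//.
    by rewrite !size_takel ?geq_minl ?geq_minr.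
  move: vu uv; rewrite !prefixE /n; have [le_uv|lt_vu] := leqP (size u) (size v).
    by move=> _; rewrite take_size eq_sym.
  by move=> + _; rewrite take_size.
have [rv|rv] := eqVneq (mkseq r (size v)) v; first by constructor 1.
constructor 3; exists (mkseq r (size v)), v.
by split; [split; rewrite ?size_mkseq//|rewrite /prefix_inf size_mkseq|exact: prefix_refl].
Qed.

Section contexts.
Variable (tree : set word).
Hypothesis tree_context : context_tree tree.

Lemma context_prefix_in_tree w c :
  contexts tree c -> fi_word_prefix w c -> tree w.
Proof.
case: tree_context => -[_ treeP] _ _.
case: c => [u [] |r cr] /=; last exact: cr.
by move=> tu _ /treeP; apply.
Qed.

(** A leaf is a maximal element of the tree, so a context is never a proper
    prefix of another one. *)
Lemma contexts_incompatible c c' :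
  contexts tree c -> contexts tree c' -> c <> c' ->
  exists w w', [/\ incompatible w w', fi_word_prefix w c & fi_word_prefix w' c'].
Proof.
(* A finite leaf has no extension in the tree, which contains all the
     prefixes of a context. *)
have leaf_max u b : contexts tree (inl u) -> contexts tree b ->
    fi_word_prefix u b -> b = inl u.
  move=> [tu leaf_u] cb ub; case: b cb ub => [v|r] cb /= ub.
    have /prefixP[[|a z] vE] := ub; first by rewrite vE cats0.
    case: (leaf_u a); apply: (context_prefix_in_tree cb) => /=.
    by rewrite vE -cat_rcons prefix_prefix.
  case: (leaf_u (r (size u))); apply: (context_prefix_in_tree cb) => /=.
  by rewrite /prefix_inf size_rcons mkseqS ub.
move=> cc cc' neq_cc'.
have main u b : contexts tree (inl u) -> contexts tree b -> b <> inl u ->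
    exists w w', [/\ incompatible w w', fi_word_prefix w b & prefix w' u].
  move=> cu cb neq; case: (fi_word_cases u b) => //.
    by move=> /(leaf_max _ _ cu cb).
  move=> [v [z [bE uE]]]; case: neq; rewrite bE; apply/esym/leaf_max => //.
    by rewrite -bE.
  by rewrite uE /= prefix_prefix.
case: c c' cc cc' neq_cc' => [u|r] c' cc cc' neq_cc'.
  have [|w [w' [[sww' neq] wc' w'u]]] := main u c' cc cc'; first by move/esym.
  by exists w', w; split=> //; split=> //; rewrite eq_sym.
case: c' cc' neq_cc' => [u'|r'] cc' neq_cc'.
  exact: (main u').
have [n rr'] : exists n, mkseq r n != mkseq r' n.
  apply: contra_notP neq_cc' => /forallNP rr'; congr inr.
  by apply: past_inj => n; apply/eqP/negPn/negP; exact: rr'.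
exists (mkseq r n), (mkseq r' n).
by split; [split; rewrite ?size_mkseq| |]; rewrite //= /prefix_inf size_mkseq.
Qed.

Lemma starts_with_fi_disj c c' : contexts tree c -> contexts tree c' ->
  c <> c' -> starts_with_fi c `&` starts_with_fi c' = set0.
Proof.
move=> cc cc' neq; apply/seteqP; split=> // s [sc sc'].
have [w [w' [[sww' neqw] wc w'c']]] := contexts_incompatible cc cc' neq.
case/eqP: neqw.
rewrite -(starts_with_fi_sub wc sc) -(starts_with_fi_sub w'c' sc').
by rewrite sww'.
Qed.

(** Follow the reversal of s down the tree: either it never leaves the tree and
    is an infinite leaf, or saturation makes the last node inside the tree a
    finite leaf. *)
Lemma exists_context s : exists2 c, contexts tree c & starts_with_fi c s.
Proof.
case: tree_context => -[tree0 treeP] sat _.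
have [treer|] := pselect (infinite_leaf tree (reverse s)).
  by exists (inr (reverse s)).
move=> /existsNP[u /not_implyP[su Nu]].
have Nn : exists n, ~~ `[< tree (past s n) >].
  by exists (size u); apply/asboolPn; rewrite /past su.
case: (ex_minnP Nn) => -[|n]; first by move=> /asboolP[].
move=> /asboolPn Nn1 n_min; exists (inl (past s n)); last first.
  by rewrite /starts_with_fi/= /prefix_inf size_past.
have tn : tree (past s n).
  apply: contrapT => Ntn; have /n_min : ~~ `[< tree (past s n) >] by apply/asboolPn.
  by rewrite ltnn.
apply: contrapT => Nleaf; apply: Nn1.
by rewrite /past mkseqS; apply: sat.
Qed.

Lemma pref_eq c s :
  contexts tree c -> starts_with_fi c s -> pref tree s = c.
Proof.
move=> cc sc; apply: xget_unique => // c' [cc' sc'].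
apply: contrapT => neq.
have : (starts_with_fi c' `&` starts_with_fi c) s by [].
by rewrite starts_with_fi_disj.
Qed.

Section stationarity.
Variables (R : realType) (q : fi_word -> probability bool R).
Variable (pi : probability left_space R).
Hypothesis pi_stationary : stationary tree q pi.

(** In the stationarity equation for the set a.A, the only nonzero term comes
    from the letter a and from sequences in A, and its weight is constant there
    because A determines the context. *)
Lemma stationary_append_set a c (A : set left_space) :
  contexts tree c -> measurable A -> A `<=` starts_with_fi c ->
  pi (append_set a A) = (q c [set a] * pi A)%E.
Proof.
move=> cc mA Ac; rewrite -(pi_stationary (measurable_append_set a mA)).
transitivity (\int[pi]_s (q c [set a] * (\1_A s)%:E))%E; last first.
  rewrite ge0_integralZl//; first by rewrite integral_indic// setIT.
  exact/measurable_EFinP/measurable_indic.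
apply: eq_integral => s _; rewrite /vlmc_kernel (bigD1 a)//= big1 ?adde0.
  rewrite diracE indicE; have [As|As] := pselect (A s).
    by rewrite (pref_eq cc (Ac _ As)) !mem_set.
  by rewrite [in RHS]memNset// mule0 memNset ?mule0// => -[].
by move=> b /eqP ba; rewrite diracE memNset ?mule0// => -[/=/ba].
Qed.

End stationarity.

End contexts.

(** * Intervals of finite and infinite words *)

Section fi_intervals.
Variables (R : realType) (pi : probability left_space R).

Lemma Iword_incompatible w w' : incompatible w w' ->
  Iword pi w `&` Iword pi w' = set0.
Proof. by case; exact: Iword_disj. Qed.

Lemma Ifi_sub w c : fi_word_prefix w c -> Ifi pi c `<=` Iword pi w.
Proof.
case: c => [u /= /prefixP[z ->]|r wr x] /=; first exact: Iword_cat_sub.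
by apply.
Qed.

Lemma Ifi_sub01 c : Ifi pi c `<=` `[0, 1].
Proof. by rewrite -(Iword_nil pi); apply: Ifi_sub; case: c => // u; exact: prefix0s. Qed.

Lemma is_interval_Ifi c : is_interval (Ifi pi c).
Proof.
case: c => [u|r] /=; first exact: is_interval_Iword.
move=> x y rx ry z xzy u ru; apply: is_interval_Iword xzy.
- exact: rx.
- exact: ry.
Qed.

Lemma Ifi_inrE r : Ifi pi (inr r) = \bigcap_n Iword pi (mkseq r n).
Proof.
apply/seteqP; split=> x /= xr.
  by move=> n _; apply: xr; rewrite /= /prefix_inf size_mkseq.
by move=> u /= <-; exact: xr.
Qed.

Lemma starts_with_fi_inrE r :
  starts_with_fi (inr r) = \bigcap_n starts_with (mkseq r n).
Proof.
rewrite starts_with_fi_inr; apply/seteqP; split=> [_ -> n _|s rs].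
  by rewrite /starts_with/= size_mkseq.
apply: past_inj => n; have := rs n I.
by rewrite /starts_with/= size_mkseq.
Qed.

Lemma mkseq_cat (r : right_seq) m n : (m <= n)%N ->
  exists z, mkseq r n = mkseq r m ++ z.
Proof.
move=> mn; exists (drop m (mkseq r n)).
by rewrite -[X in _ = X ++ _](take_past (r : left_space) mn) cat_take_drop.
Qed.

(** For an infinite word both sides are limits along its prefixes, by
    continuity from above. *)
Lemma lebesgue_measure_Ifi c :
  lebesgue_measure (Ifi pi c) = pi (starts_with_fi c).
Proof.
case: c => [u|r]; first exact: lebesgue_measure_Iword.
have cvgI : lebesgue_measure (Iword pi (mkseq r n)) @[n --> \oo] -->
    lebesgue_measure (Ifi pi (inr r)).
  rewrite Ifi_inrE; apply: nonincreasing_cvg_mu => //.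
  - rewrite /= lebesgue_measure_Iword (le_lt_trans (probability_le1 _ _)) ?ltry//.
    exact: measurable_starts_with.
  - by move=> n; exact: measurable_Iword.
  - by apply: bigcapT_measurable => n; exact: measurable_Iword.
  - move=> m n /(mkseq_cat r)[z ->]; apply/subsetPset; exact: Iword_cat_sub.
have cvgS : pi (starts_with (mkseq r n)) @[n --> \oo] -->
    pi (starts_with_fi (inr r)).
  rewrite starts_with_fi_inrE; apply: nonincreasing_cvg_mu => //.
  - by rewrite (le_lt_trans (probability_le1 _ _)) ?ltry//; exact: measurable_starts_with.
  - by move=> n; exact: measurable_starts_with.
  - by apply: bigcapT_measurable => n; exact: measurable_starts_with.
  - move=> m n /(mkseq_cat r)[z ->]; apply/subsetPset; exact: starts_with_cat_sub.
have : (fun n => lebesgue_measure (Iword pi (mkseq r n))) =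
    (fun n => pi (starts_with (mkseq r n))).
  by apply/funext => n; exact: lebesgue_measure_Iword.
by move=> E; rewrite E in cvgI; exact: cvg_unique cvgI cvgS.
Qed.

End fi_intervals.

Section interior.
Variable R : realType.
Implicit Type X : set R.

Lemma interior_intervalE X : is_interval X -> X `<=` `[0, 1] ->
  X° = `]inf X, sup X[%classic.
Proof.
move=> iX X01; rewrite interval_bounded_interior//.
- by exists 0 => x /X01/=; rewrite in_itv/= => /andP[].
- by exists 1 => x /X01/=; rewrite in_itv/= => /andP[].
Qed.

Lemma measurable_interior_interval X : is_interval X -> X `<=` `[0, 1] ->
  measurable X°.
Proof. by move=> iX X01; rewrite interior_intervalE//; exact: measurable_itv. Qed.

Lemma lebesgue_measure_interior_interval X :
  is_interval X -> X `<=` `[0, 1] ->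
  lebesgue_measure X° = lebesgue_measure X.
Proof.
move=> iX X01; have mX := is_interval_measurable iX.
apply/eqP; rewrite eq_le; apply/andP; split.
  rewrite le_measure// ?inE//; first exact: measurable_interior_interval.
  exact: interior_subset.
apply: (@le_trans _ _ (lebesgue_measure `[inf X, sup X])).
  apply: le_measure; rewrite ?inE// => x Xx /=; rewrite in_itv/=; apply/andP; split.
    by apply: ge_inf Xx; exists 0 => y /X01/=; rewrite in_itv/= => /andP[].
  by apply: ub_le_sup Xx; exists 1 => y /X01/=; rewrite in_itv/= => /andP[].
by rewrite interior_intervalE// !lebesgue_measure_itv.
Qed.

End interior.

(** * Lebesgue measure on the line *)

Section affine.
Variables (R : realType) (k l : R).

Definition affine (x : R) : measurableTypeR R := k * x + l.

Lemma measurable_affine : measurable_fun setT affine.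
Proof.
by apply: (@measurable_funD _ _ _ _ ( *%R k) (cst l)) => //; exact: mulrl_measurable.
Qed.

Lemma preimage_affine_itv (a b : R) : 0 < k ->
  affine @^-1` `]a, b] = `](a - l) / k, (b - l) / k]%classic.
Proof.
move=> k0; apply/seteqP; split=> x; rewrite /affine /= !in_itv/=;
  by rewrite ltr_pdivrMr// ler_pdivlMr// ltrBlDr lerBrDr mulrC.
Qed.

(** The image of Lebesgue measure under an increasing affine map, multiplied by
    the slope, agrees with Lebesgue measure on the half-open intervals, hence
    on all Borel sets. *)
Lemma lebesgue_measure_affine (B : set R) : 0 < k -> measurable B ->
  (k%:E * lebesgue_measure (affine @^-1` B))%E = lebesgue_measure B.
Proof.
move=> k0 mB; pose k' := NngNum (ltW k0).
apply/esym; unshelve refine (@lebesgue_measure_unique R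
  (mscale k' (pushforward lebesgue_measure affine)) _ B mB).
  exact: measurable_affine.
move=> X /ocitvP[->|[[a b]/= ab ->]]; first by rewrite !measure0.
rewrite /mscale/= /pushforward preimage_affine_itv// !lebesgue_measure_itv/=.
rewrite !lte_fin ltr_pM2r ?invr_gt0// ltrD2r ab -!EFinB -EFinM.
by congr EFin; field; exact: lt0r_neq0.
Qed.

End affine.

Section left_continuous.
Variable R : realType.

(** Sampling f at the largest grid point strictly below x yields Borel
    functions, constant on the cells of the grid, which converge to f by left
    continuity. *)
Lemma left_continuous_measurable (f : R -> R) (a b : R) :
  (forall x, a < x <= b -> f y @[y --> x^'-] --> f x) ->
  measurable_fun `]a, b] f.
Proof.
move=> f_left.
(* The ceiling minus one makes the grid point differ from x also when x itself
     is on the grid. *)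
pose grid (n : nat) (x : R) : R := (Num.ceil (n.+1%:R * x) - 1)%:~R / n.+1%:R.
have n0 n : 0 < n.+1%:R :> R by [].
have grid_lt n x : grid n x < x.
  by rewrite /grid ltr_pdivrMr// mulrC ceilB1_lt.
have grid_ge n x : x - n.+1%:R^-1 <= grid n x.
  rewrite /grid lerBlDr -[X in _ + X]div1r -mulrDl ler_pdivlMr// mulrC.
  by rewrite intrB subrK; case/andP: (ceil_itv (n.+1%:R * x)).
apply: (@measurable_fun_cvg _ _ _ _ (fun n => f \o grid n)) => [n|x abx].
  apply: measurable_funTS => _ B mB; rewrite setTI.
  rewrite (_ : _ @^-1` B = \bigcup_(k : int) [set x |
      f ((k - 1)%:~R / n.+1%:R) \in B /\ Num.ceil (n.+1%:R * x) = k]).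
    apply: countable_bigcupT_measurable; first exact: countableP.
    move=> k; rewrite [X in measurable X](_ : _ =
      if f ((k - 1)%:~R / n.+1%:R) \in B then
        `](k - 1)%:~R / n.+1%:R, k%:~R / n.+1%:R]%classic else set0).
      by case: ifP.
    apply/seteqP; split=> x /=.
      move=> [-> /eqP]; rewrite ceil_eq /= in_itv/=.
      by rewrite ltr_pdivrMr// ler_pdivlMr// mulrC.
    case: ifP => //= _; rewrite in_itv/= ltr_pdivrMr// ler_pdivlMr// mulrC.
    by rewrite -ceil_eq => /eqP.
  apply/seteqP; split=> x /=.
    by move=> Bx; exists (Num.ceil (n.+1%:R * x)) => //; split=> //; exact: mem_set.
  by case=> k _ [+ kE]; rewrite /= -kE => /set_mem.
move: abx; rewrite /= in_itv/= => /f_left/cvg_at_leftP; apply; split=> //.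
apply: (@squeeze_cvgr _ _ _ _ (fun n => x - n.+1%:R^-1) (fun _ => x)).
- by near=> n; rewrite grid_ge ltW.
- rewrite -[X in _ --> X]subr0; apply: cvgB; first exact: cvg_cst.
  exact: cvg_harmonic.
- exact: cvg_cst.
Unshelve. all: by end_near. Qed.

End left_continuous.

Lemma measure_setD_null d (X : measurableType d) (R : realType)
    (mu : {measure set X -> \bar R}) (N A : set X) :
  measurable N -> mu N = 0%E -> measurable A -> mu A = mu (A `\` N).
Proof.
move=> mN N0 mA; rewrite (measureDI mu mA mN) [X in (_ + X)%E](_ : _ = 0%E) ?adde0//.
by apply: subset_measure0 N0 => //; exact: measurableI.
Qed.

Section exhaustion.
Variables (R : realType) (F : (set R)^nat).
Hypotheses (mF : forall n, measurable (F n)) (tF : trivIset setT F).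
Hypothesis F01 : forall n, F n `<=` `[0, 1].
Hypothesis sumF : (\sum_(n <oo) lebesgue_measure (F n) = 1)%E.

(** Disjoint pieces of [0, 1] with total length 1 leave out a null set only,
    so that measures can be computed piece by piece. *)
Lemma exhaustion_null : lebesgue_measure (`[0, 1] `\` \bigcup_n F n) = 0%E.
Proof.
have mU : measurable (\bigcup_n F n) by exact: bigcupT_measurable.
have I1 : lebesgue_measure `[0, 1 : R] = 1%E.
  by rewrite lebesgue_measure_itv/= lte_fin ltr01 sube0.
have UE : lebesgue_measure (\bigcup_n F n) = 1%E.
  have -> := @measure_bigcup _ _ _ lebesgue_measure setT F (fun n _ => mF n) tF.
  by apply: etrans sumF; apply: eq_eseriesl => n; rewrite in_setT.
rewrite measureD// ?[X in (X < _)%E]I1 ?ltry//.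
rewrite [X in (X - _)%E]I1 setIidr; last by move=> x [n _]; exact: F01.
by rewrite [X in (_ - X)%E]UE subee.
Qed.

Lemma exhaustion_sum (A : set R) : measurable A -> A `<=` `[0, 1] ->
  lebesgue_measure A = (\sum_(n <oo) lebesgue_measure (A `&` F n))%E.
Proof.
move=> mA A01; have mU : measurable (\bigcup_n F n) by exact: bigcupT_measurable.
have AU0 : lebesgue_measure (A `\` \bigcup_n F n) = 0%E.
  apply: subset_measure0 exhaustion_null; [exact: measurableD..|].
  by move=> x [/A01].
have -> := measureDI lebesgue_measure mA mU; rewrite [X in (X + _)%E]AU0 add0e.
rewrite setI_bigcupr.
rewrite [LHS](@measure_bigcup _ _ _ lebesgue_measure setT (fun n => A `&` F n)).
- by apply: eq_eseriesl => n; rewrite in_setT.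
- move=> n _; apply: measurableI; [exact: mA|exact: mF].
- exact: trivIset_setIl.
Qed.

End exhaustion.

(** * The mapping on its affine pieces *)

(** An open interval determines its endpoints, so the values of T inside the
    interval I_ac alone locate the affine map at its left end. *)
Lemma affine_left_end (R : realFieldType) (k l a b c d : R) : 0 < k -> a < b ->
  (forall x, (c < k * x + l < d) = (a < x < b)) -> k * a + l = c.
Proof.
move=> k0 ab h.
have mid : a < (a + b) / 2 < b by apply/andP; split; lra.
apply/le_anti/andP; split.
  rewrite leNgt; apply/negP => ca; have := h a; rewrite ltxx ca/= => /negbT/negP; apply.
  have := h ((a + b) / 2); rewrite mid => /andP[_]; apply: lt_trans.
  by rewrite ltrD2r ltr_pM2l//; case/andP: mid.
rewrite leNgt; apply/negP => ac.
(* A point of ]a, b[ whose image does not exceed c. *)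
pose x := Num.min ((a + b) / 2) ((c - l) / k).
have : a < x < b.
  case/andP: mid => am mb; rewrite /x lt_min am gt_min mb/= andbT.
  by rewrite ltr_pdivlMr// ltrBrDr mulrC.
rewrite -h => /andP[]; rewrite ltNge => /negP; case.
by rewrite -lerBrDr mulrC -ler_pdivlMr// /x ge_min lexx orbT.
Qed.

Lemma probability_bool (R : realType) (p : probability bool R) :
  (p [set false] + p [set true] = 1)%E.
Proof.
rewrite -(probability_setT p) -measureU//.
- by congr (p _); apply/seteqP; split=> // -[] _; [right|left].
- by apply/seteqP; split=> // -[] [].
Qed.

Section mapping.
Variables (R : realType) (tree : set word) (q : fi_word -> probability bool R).
Variables (pi : probability left_space R) (T : R -> R).
Hypothesis tree_context : context_tree tree.
Hypothesis pi_stationary : stationary tree q pi.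
Hypothesis T_mapping : vlmc_mapping pi tree T.
Notation I c := (Ifi pi c)°.

Notation Iunit := (`[0%R, 1%R]%classic : set R).

Lemma measurable_T : measurable_fun Iunit T.
Proof.
have -> : Iunit = [set 0] `|` `]0, 1].
  by rewrite -(@setU1itv _ _ _ 0 false)// bnd_simp.
apply/measurable_funU => //; split; first exact: measurable_fun_set1.
by apply: left_continuous_measurable; exact: vlmc_mapping_left T_mapping.
Qed.

Lemma measurable_preimage_T (B : set R) :
  measurable B -> measurable (Iunit `&` T @^-1` B).
Proof. by move=> mB; exact: (measurable_T (measurable_itv _) mB). Qed.

Lemma interior_Ifi_sub01 c : I c `<=` Iunit.
Proof. by move=> x /interior_subset/Ifi_sub01. Qed.

Lemma measurable_interior_Ifi c : measurable (I c).
Proof.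
apply: measurable_interior_interval; [exact: is_interval_Ifi|exact: Ifi_sub01].
Qed.

Lemma measurable_interior_preimage c (B : set R) :
  measurable B -> measurable (I c `&` T @^-1` B).
Proof.
move=> mB; rewrite -(setIidl (@interior_Ifi_sub01 c)) -setIA.
by apply: measurableI; [exact: measurable_interior_Ifi|exact: measurable_preimage_T].
Qed.

Lemma lebesgue_measure_interior_Ifi c : lebesgue_measure (I c) = pi (starts_with_fi c).
Proof.
rewrite lebesgue_measure_interior_interval ?lebesgue_measure_Ifi//.
- exact: is_interval_Ifi.
- exact: Ifi_sub01.
Qed.

(** The length |I_ac| = q_c(a) |I_c|: this is [stationary_append_set] for the
    set of all sequences with context c. *)
Lemma lebesgue_measure_interior_cons a c : contexts tree c ->
  lebesgue_measure (I (fi_cons a c)) =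
  (q c [set a] * lebesgue_measure (I c))%E.
Proof.
move=> cc; rewrite !lebesgue_measure_interior_Ifi -append_set_starts_with_fi.
by rewrite (stationary_append_set tree_context pi_stationary a cc)//;
  exact: measurable_starts_with_fi.
Qed.

(** On the interior of I_ac the slope k and q_c(a) are inverse to each other.
    The preimage of the interior of I_c under the affine map, taken on the whole
    line, is exactly the interior of I_ac, because T is onto and the affine map
    is injective; this turns questions about T into questions about an affine
    map. *)
Lemma T_affine a c : contexts tree c ->
  (0 < lebesgue_measure (Ifi pi (fi_cons a c)))%E ->
  exists k l, [/\ 0 < k, forall x, I (fi_cons a c) x -> T x = k * x + l,
    forall x, I c (k * x + l) <-> I (fi_cons a c) x &
    k * fine (q c [set a]) = 1].
Proof.
move=> cc pos; have [[k [l [k0 TE]]] [TI _ Tsurj]] :=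
  vlmc_mapping_affine T_mapping cc pos.
have IE x : I c (k * x + l) <-> I (fi_cons a c) x.
  split=> [/Tsurj[y Iy]|Ix]; last by rewrite -TE//; exact: TI.
  rewrite TE// => /addIr/(mulfI (lt0r_neq0 k0)) <-.
  exact: Iy.
exists k, l; split=> //.
(* Together with |I_ac| = q_c(a) |I_c| > 0 this gives k q_c(a) = 1. *)
have kI : (k%:E * lebesgue_measure (I (fi_cons a c)) = lebesgue_measure (I c))%E.
  rewrite -(lebesgue_measure_affine l k0 (measurable_interior_Ifi c)).
  congr (_ * lebesgue_measure _)%E.
  by apply/seteqP; split=> x; rewrite /preimage/affine/= -IE.
move: pos; rewrite lebesgue_measure_Ifi -lebesgue_measure_interior_Ifi => pos.
have fin : lebesgue_measure (I (fi_cons a c)) \is a fin_num.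
  rewrite lebesgue_measure_interior_Ifi fin_num_measure//.
  exact: measurable_starts_with_fi.
have qfin : q c [set a] \is a fin_num by rewrite fin_num_measure.
have := lebesgue_measure_interior_cons a cc; rewrite -kI -(fineK fin) -(fineK qfin).
rewrite -!EFinM => /(congr1 fine)/= h.
have m0 : fine (lebesgue_measure (I (fi_cons a c))) != 0.
  by rewrite gt_eqF// -lte_fin fineK.
by apply: (mulIf m0); rewrite mul1r [RHS]h /= mulrCA mulrA mulrAC.
Qed.

Lemma interior_nonempty_gt0 a c x : I (fi_cons a c) x ->
  (0 < lebesgue_measure (Ifi pi (fi_cons a c)))%E.
Proof.
move=> Ix; rewrite lebesgue_measure_Ifi -lebesgue_measure_interior_Ifi.
move: Ix; rewrite interior_intervalE; [|exact: is_interval_Ifi|exact: Ifi_sub01].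
rewrite /= in_itv/= lebesgue_measure_itv/= lte_fin => /andP[ax xb].
by rewrite (lt_trans ax xb) -EFinB lte_fin subr_gt0 (lt_trans ax xb).
Qed.

(** If I_ac has length 0 then q_c(a) = 0 or |I_c| = 0; otherwise the factor is
    the inverse of the slope. *)
Lemma lebesgue_measure_piece a c (B : set R) :
  contexts tree c -> measurable B ->
  lebesgue_measure (I (fi_cons a c) `&` T @^-1` B) =
  (q c [set a] * lebesgue_measure (B `&` I c))%E.
Proof.
move=> cc mB; have mBI : measurable (B `&` I c).
  by apply: measurableI => //; exact: measurable_interior_Ifi.
have [I0|] := eqVneq (lebesgue_measure (I (fi_cons a c))) 0%E.
  transitivity (0%E : \bar R).
    apply: subset_measure0 I0.
    - exact: measurable_interior_preimage.
    - exact: measurable_interior_Ifi.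
    - exact: subIsetl.
  apply/esym/eqP; rewrite eq_le mule_ge0// andbT.
  rewrite -I0 lebesgue_measure_interior_cons// lee_wpmul2l//.
  by apply: le_measure; rewrite ?inE//; exact: measurable_interior_Ifi.
rewrite -measure_gt0 => pos.
have pos' : (0 < lebesgue_measure (Ifi pi (fi_cons a c)))%E.
  by rewrite lebesgue_measure_Ifi -lebesgue_measure_interior_Ifi.
have [k [l [k0 TE IE kq]]] := T_affine cc pos'.
have -> : I (fi_cons a c) `&` T @^-1` B = affine k l @^-1` (B `&` I c).
  apply/seteqP; split=> x; rewrite /preimage /affine/=.
    by move=> [Ix]; rewrite TE// => Bx; split=> //; exact/IE.
  by move=> [Bx /IE Ix]; split=> //; rewrite TE.
rewrite -[in RHS](lebesgue_measure_affine l k0 mBI) muleA.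
rewrite -[X in ((X * _) * _)%E]fineK; last by rewrite fin_num_measure.
by rewrite -EFinM mulrC kq mul1e.
Qed.

Lemma Ifi_cons_disj a a' c c' : contexts tree c -> contexts tree c' ->
  (a, c) <> (a', c') ->
  Ifi pi (fi_cons a c) `&` Ifi pi (fi_cons a' c') = set0.
Proof.
move=> cc cc' neq.
have [w [w' [ww' wc w'c']]] : exists w w', [/\ incompatible w w',
    fi_word_prefix w (fi_cons a c) & fi_word_prefix w' (fi_cons a' c')].
  have [aa'|aa'] := eqVneq a a'.
    have [w [w' [[sww' neqw] wc w'c']]] : exists w w', [/\ incompatible w w',
        fi_word_prefix w c & fi_word_prefix w' c'].
      apply: (contexts_incompatible tree_context cc cc') => ccE.
      by apply: neq; rewrite aa' ccE.
    exists (a :: w), (a' :: w'); split; try exact: fi_word_prefix_cons.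
    by split; [rewrite /= sww'|rewrite eqseq_cons aa' eqxx].
  have nilP b : fi_word_prefix [::] b by case: b => // u; exact: prefix0s.
  exists [:: a], [:: a']; split; try exact: fi_word_prefix_cons.
  by split=> //; rewrite eqseq_cons andbT.
rewrite -subset0 -(Iword_incompatible pi ww').
by apply: setISS; exact: Ifi_sub.
Qed.

Lemma Ifi_disj c c' : contexts tree c -> contexts tree c' -> c <> c' ->
  Ifi pi c `&` Ifi pi c' = set0.
Proof.
move=> cc cc' /(contexts_incompatible tree_context cc cc')[w [w' [ww' wc w'c']]].
rewrite -subset0 -(Iword_incompatible pi ww').
by apply: setISS; exact: Ifi_sub.
Qed.

(** Up to a null set, the preimage of I_c under T. *)
Definition branch c := I (fi_cons false c) `|` I (fi_cons true c).

Lemma measurable_branch c : measurable (branch c).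
Proof. by apply: measurableU; exact: measurable_interior_Ifi. Qed.

Lemma branch_sub01 c : branch c `<=` Iunit.
Proof. by move=> x [] /interior_Ifi_sub01. Qed.

(** The weights q_c(0) and q_c(1) of the two pieces add up to 1.  This is the
    invariance of Lebesgue measure, localized at the context c. *)
Lemma lebesgue_measure_preimage_branch c (B : set R) :
  contexts tree c -> measurable B ->
  lebesgue_measure ((Iunit `&` T @^-1` B) `&` branch c) =
  lebesgue_measure (B `&` I c).
Proof.
move=> cc mB; rewrite setIC setIA (setIidl (@branch_sub01 c)) setIUl.
have mBI : measurable (B `&` I c).
  by apply: measurableI => //; exact: measurable_interior_Ifi.
have -> : lebesgue_measure (I (fi_cons false c) `&` T @^-1` B `|`
    I (fi_cons true c) `&` T @^-1` B) =
   (lebesgue_measure (I (fi_cons false c) `&` T @^-1` B) +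
    lebesgue_measure (I (fi_cons true c) `&` T @^-1` B))%E.
  rewrite measureU//; try exact: measurable_interior_preimage.
  rewrite -subset0 => x [[/interior_subset x0 _] [/interior_subset x1 _]].
  have : (Ifi pi (fi_cons false c) `&` Ifi pi (fi_cons true c)) x by [].
  by rewrite Ifi_cons_disj// => -[].
rewrite !lebesgue_measure_piece// -ge0_muleDl//.
by rewrite probability_bool mul1e.
Qed.

Lemma lebesgue_measure_branch c : contexts tree c ->
  lebesgue_measure (branch c) = pi (starts_with_fi c).
Proof.
move=> cc; rewrite -lebesgue_measure_interior_Ifi -[RHS](congr1 _ (setTI _)).
rewrite -(lebesgue_measure_preimage_branch cc measurableT) preimage_setT setIT.
by rewrite setIidr//; exact: branch_sub01.
Qed.

Lemma branch_disj c c' : contexts tree c -> contexts tree c' -> c <> c' ->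
  branch c `&` branch c' = set0.
Proof.
move=> cc cc' neq.
have branchP b x : branch b x -> exists a, Ifi pi (fi_cons a b) x.
  by case=> /interior_subset ?; [exists false|exists true].
rewrite -subset0 => x [/branchP[a xa] /branchP[a' xa']].
have : (Ifi pi (fi_cons a c) `&` Ifi pi (fi_cons a' c')) x by [].
by rewrite Ifi_cons_disj// => -[].
Qed.

(** * Invariance of Lebesgue measure *)

Lemma exists_rank : exists r : fi_word -> nat, {in contexts tree &, injective r}.
Proof.
by case: tree_context => _ _ /countable_injP[f finj]; exists f => c c' cc cc'; exact: finj.
Qed.

(** Contexts are indexed by natural numbers, because countable additivity is
    about sequences of sets. *)
Definition rank : fi_word -> nat := sval (cid exists_rank).

Lemma rank_inj c c' :
  contexts tree c -> contexts tree c' -> rank c = rank c' -> c = c'.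
Proof.
by move=> cc cc'; apply: (svalP (cid exists_rank)); rewrite inE.
Qed.

(** The union has at most one term; a rank that no context has contributes the
    empty set. *)
Definition layer (X : Type) (G : fi_word -> set X) (n : nat) : set X :=
  \bigcup_(c in [set c | contexts tree c /\ rank c = n]) G c.

Lemma layerP X (G : fi_word -> set X) n :
  (exists2 c, contexts tree c & forall Y (K : fi_word -> set Y), layer K n = K c) \/
  (forall Y (K : fi_word -> set Y), layer K n = set0).
Proof.
have [[c [cc cn]]|Nc] := pselect (exists c, contexts tree c /\ rank c = n).
  left; exists c => // Y K; apply/seteqP; split=> x; last by exists c.
  by case=> c' /= [cc' c'n]; rewrite (rank_inj cc cc')// cn c'n.
right=> Y K; apply/seteqP; split=> // x [c cn].
by case: Nc; exists c.
Qed.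

Lemma trivIset_layer X (G : fi_word -> set X) :
  (forall c c', contexts tree c -> contexts tree c' -> c <> c' ->
    G c `&` G c' = set0) -> trivIset setT (layer G).
Proof.
move=> G0; apply/trivIsetP => m n _ _ /eqP mn.
rewrite -subset0 => x [[c [cc cm] xc] [c' [cc' c'n] xc']].
have : (G c `&` G c') x by [].
by rewrite G0//; move=> cE; apply: mn; rewrite -cm -c'n cE.
Qed.

Lemma measurable_layer d (X : measurableType d) (G : fi_word -> set X) n :
  (forall c, measurable (G c)) -> measurable (layer G n).
Proof. by move=> mG; case: (layerP G n) => [[c _]|] ->. Qed.

Lemma sum_starts_with_layer : (\sum_(n <oo) pi (layer starts_with_fi n) = 1)%E.
Proof.
rewrite -(probability_setT pi).
have -> : [set: left_space] = \bigcup_n layer starts_with_fi n.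
  apply/seteqP; split=> // s _.
  have [c cc sc] := exists_context tree_context s.
  by exists (rank c) => //; exists c.
rewrite measure_bigcup.
- by apply: eq_eseriesl => n; rewrite in_setT.
- by move=> n _; apply: measurable_layer; exact: measurable_starts_with_fi.
- by apply: trivIset_layer; exact: starts_with_fi_disj.
Qed.

(** The sets of sequences with a given context partition the whole space, so
    any family of sets with the same measures has total length 1. *)
Lemma sum_layer (G : fi_word -> set R) :
  (forall c, contexts tree c -> lebesgue_measure (G c) = pi (starts_with_fi c)) ->
  (\sum_(n <oo) lebesgue_measure (layer G n) = 1)%E.
Proof.
move=> GE; rewrite -sum_starts_with_layer; apply: eq_eseriesr => n _.
by have [[c cc E]|E] := layerP G n; rewrite !E ?measure0// GE.
Qed.

Lemma sub_layer (G : fi_word -> set R) n :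
  (forall c, G c `<=` Iunit) -> layer G n `<=` Iunit.
Proof. by move=> G1 x [c _] /G1. Qed.

(** The pieces [branch c] exhaust [0, 1] on the source side and the interiors of
    the I_c do so on the target side; the two sums agree term by term. *)
Lemma T_preserves_lebesgue (B : set R) : measurable B -> B `<=` Iunit ->
  lebesgue_measure (Iunit `&` T @^-1` B) = lebesgue_measure B.
Proof.
move=> mB B1.
have -> := @exhaustion_sum R (layer branch) _ _ _ _ _
  (measurable_preimage_T mB) _; last first.
- exact: subIsetl.
- by apply: sum_layer => c cc; exact: lebesgue_measure_branch.
- by move=> n; apply: sub_layer; exact: branch_sub01.
- by apply: trivIset_layer; exact: branch_disj.
- by move=> n; apply: measurable_layer; exact: measurable_branch.
have -> := @exhaustion_sum R (layer (fun c => I c)) _ _ _ _ _ mB B1; last first.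
- by apply: sum_layer => c _; exact: lebesgue_measure_interior_Ifi.
- by move=> n; apply: sub_layer; exact: interior_Ifi_sub01.
- apply: trivIset_layer => c c' cc cc' neq.
  by rewrite -interiorI Ifi_disj// interior0.
- by move=> n; apply: measurable_layer; exact: measurable_interior_Ifi.
apply: eq_eseriesr => n _.
have [[c cc E]|E] := layerP branch n; rewrite !E.
  exact: lebesgue_measure_preimage_branch.
by rewrite !setI0 !measure0.
Qed.

(** * Itineraries *)

Definition regular : set R := \bigcup_n layer branch n.

Lemma measurable_regular : measurable regular.
Proof.
apply: bigcupT_measurable => n; apply: measurable_layer; exact: measurable_branch.
Qed.

Lemma regularP x : regular x ->
  exists a c, contexts tree c /\ I (fi_cons a c) x.
Proof. by move=> [n _ [c [cc _] []]]; [exists false, c|exists true, c]. Qed.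

Lemma irregular_null : lebesgue_measure (Iunit `\` regular) = 0%E.
Proof.
apply: exhaustion_null.
- by move=> n; apply: measurable_layer; exact: measurable_branch.
- by apply: trivIset_layer; exact: branch_disj.
- by move=> n; apply: sub_layer; exact: branch_sub01.
- by apply: sum_layer => c cc; exact: lebesgue_measure_branch.
Qed.

(** If v is a prefix of c, or if v and c are incompatible, both sides are decided
    by c alone.  If v extends a finite context u, the endpoints have to be
    followed: their distances to the left ends of I_u and I_(a u) are masses of
    sets of sequences with context u, and differ by the factor q_u(a). *)
Lemma T_shifts_Iword a c v x : contexts tree c -> I (fi_cons a c) x ->
  Iword pi v (T x) <-> Iword pi (a :: v) x.
Proof.
move=> cc Ix; have pos := interior_nonempty_gt0 Ix.
have [k [l [k0 TE IE kq]]] := T_affine cc pos.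
have ITx : I c (T x) by rewrite TE//; apply/IE.
have [vc|[u [z [cE vE]]]|[w [w' [ww' wc w'v]]]] := fi_word_cases v c.
- split=> _; last exact: (Ifi_sub vc (interior_subset ITx)).
  exact: (Ifi_sub (fi_word_prefix_cons a vc) (interior_subset Ix)).
- subst c v; rewrite /= in pos TE IE kq Ix ITx cc *.
  (* Appending the letter a multiplies masses by q_u(a) = 1 / k. *)
  have scale (A : set left_space) : measurable A -> A `<=` starts_with u ->
      k * mass pi (append_set a A) = mass pi A.
    move=> mA Au; rewrite /mass.
    rewrite (stationary_append_set tree_context pi_stationary a
      (cc : contexts tree (inl u)))//.
    by rewrite fineM ?fin_num_measure// mulrA kq mul1r.
  have L : k * left_end pi (a :: u) + l = left_end pi u.
    apply: (@affine_left_end _ _ _ _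
      (left_end pi (a :: u) + mass pi (starts_with (a :: u)))
      _ (left_end pi u + mass pi (starts_with u))) => //.
      by move: Ix; rewrite interior_Iword /= in_itv/= => /andP[]; exact: lt_trans.
    move=> y; have := IE y; rewrite !interior_Iword /= !in_itv/= => h.
    by apply/idP/idP => /h.
  have Lz : k * left_end pi (a :: u ++ z) + l = left_end pi (u ++ z).
    rewrite -cat_cons !left_end_cat mulrDr addrAC L; congr (_ + _).
    rewrite -(scale (starts_with_below u z)); last by move=> s [].
      congr (_ * mass _ _); apply/seteqP; split=> s;
        rewrite /starts_with_below /append_set /starts_with/= past_shift -iterSr.
        by move=> [[-> ->]].
      by move=> [-> [-> ]].
    exact: measurable_starts_with_below.
  have Mz : k * mass pi (starts_with (a :: u ++ z)) = mass pi (starts_with (u ++ z)).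
    rewrite -append_set_starts scale//; first exact: measurable_starts_with.
    exact: starts_with_cat_sub.
  have gt0 w y : (Iword pi w)° y -> 0 < y.
    rewrite interior_Iword /= in_itv/= => /andP[+ _].
    exact: le_lt_trans (left_end_ge0 _ _).
  rewrite !Iword_gt0 ?(gt0 _ _ Ix) ?(gt0 _ _ ITx)//.
  rewrite -Lz -Mz TE// ltrD2r ltr_pM2l//.
  by rewrite addrAC lerD2r -mulrDr ler_pM2l.
- have disj A (w1 w1' : word) y : incompatible w1 w1' ->
      Iword pi w1 y -> Iword pi w1' y -> A.
    move=> ww1 y1 y1'; suff : (Iword pi w1 `&` Iword pi w1') y.
      by rewrite Iword_incompatible.
    by [].
  split=> [vTx|vx]; exfalso.
    apply: (disj _ _ _ _ ww' (Ifi_sub wc (interior_subset ITx))).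
    by case/prefixP: w'v vTx => z ->; exact: Iword_cat_sub.
  apply: (disj _ (a :: w) (a :: w') x).
  - by case: ww' => sww' neq; split; [rewrite /= sww'|rewrite eqseq_cons eqxx].
  - exact: (Ifi_sub (fi_word_prefix_cons a wc) (interior_subset Ix)).
  - by case/prefixP: w'v vx => z ->; exact: (@Iword_cat_sub _ _ (a :: w')).
Qed.

Section coding.
Variable rho : R -> bool.
Hypothesis rho_coding : coding_function pi rho.

Definition itinerary (v : word) : set R :=
  [set x | Iunit x /\ mkseq (fun n => rho (iter n T x)) (size v) = v].

Lemma T_unit x : Iunit x -> Iunit (T x).
Proof. exact: vlmc_mapping_fun T_mapping x. Qed.

Lemma Iword_letters x : Iunit x -> exists a, Iword pi [:: a] x.
Proof.
have L1 : left_end pi [:: true] = mass pi (starts_with [:: false]).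
  rewrite left_endE; congr (mass pi _); apply/seteqP; split=> s;
    by rewrite /starts_below /starts_with/= past_shift ltxi_cons; case: (_ 0%N).
have sum1 : mass pi (starts_with [:: false]) + mass pi (starts_with [:: true]) = 1.
  rewrite -massU -?(mass_setT pi); [|exact: measurable_starts_with..|].
    congr (mass pi _); apply/seteqP; split=> // s _.
    by rewrite /starts_with/= past_shift; case: (_ 0%N); [right|left].
  by rewrite -subset0 => s []; rewrite /starts_with/= => ->.
rewrite /= in_itv/= => /andP[x0 x1].
have [xm|xm] := leP x (mass pi (starts_with [:: false])).
  by exists false; rewrite (Iword_nseq0E pi _).1//= in_itv/= x0.
by exists true; rewrite Iword_neq0E//= in_itv/= L1 sum1 xm.
Qed.

Lemma rhoE a x : Iunit x -> rho x = a <-> Iword pi [:: a] x.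
Proof.
move=> x1; split; last exact: rho_coding.
by have [b xb] := Iword_letters x1; rewrite (rho_coding xb) => <-.
Qed.

Lemma itinerary_nil : itinerary [::] = Iunit.
Proof. by apply/seteqP; split=> x; [case|split]. Qed.

Lemma itinerary_cons a v :
  itinerary (a :: v) = Iword pi [:: a] `&` (Iunit `&` T @^-1` itinerary v).
Proof.
have E x : mkseq (fun n => rho (iter n T x)) (size (a :: v)) =
    rho x :: mkseq (fun n => rho (iter n T (T x))) (size v).
  rewrite /mkseq/= (iotaDl 1 0) -map_comp; congr (_ :: _).
  by apply: eq_map => n; rewrite /= -iterSr.
apply/seteqP; split=> x; rewrite /itinerary /preimage /= E.
  move=> [x1 [rx vx]]; split; first exact/rhoE.
  by split=> //; split=> //; exact: T_unit.
by move=> [xa [x1 [_ vx]]]; split=> //; rewrite vx; congr (_ :: _); exact/rhoE.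
Qed.

Lemma measurable_itinerary v : measurable (itinerary v).
Proof.
elim: v => [|a v ih]; first by rewrite itinerary_nil; exact: measurable_itv.
rewrite itinerary_cons; apply: measurableI; first exact: measurable_Iword.
exact: measurable_preimage_T.
Qed.

Lemma itinerary_sub01 v : itinerary v `<=` Iunit.
Proof. by move=> x []. Qed.

(** The points of [0, 1] whose n-th iterate falls outside the interiors, written
    as an iterated preimage so that invariance applies at each step. *)
Definition orbit_escape n : set R :=
  iter n (fun B => Iunit `&` T @^-1` B) (Iunit `\` regular).

Lemma orbit_escape_sub n : orbit_escape n `<=` Iunit.
Proof. by case: n => [|n] x []. Qed.

Lemma measurable_orbit_escape n : measurable (orbit_escape n).
Proof.
elim: n => [|n ih]; last exact: measurable_preimage_T.
apply: measurableD; [exact: measurable_itv|exact: measurable_regular].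
Qed.

Lemma orbit_escape_null n : lebesgue_measure (orbit_escape n) = 0%E.
Proof.
elim: n => [|n ih]; first exact: irregular_null.
rewrite /= T_preserves_lebesgue//; first exact: measurable_orbit_escape.
exact: orbit_escape_sub.
Qed.

Definition exceptional : set R := \bigcup_n orbit_escape n.

Lemma measurable_exceptional : measurable exceptional.
Proof. by apply: bigcupT_measurable => n; exact: measurable_orbit_escape. Qed.

Lemma exceptional_null : lebesgue_measure exceptional = 0%E.
Proof.
apply: measure_negligible; first exact: measurable_exceptional.
apply: negligible_bigcup => n; apply/negligibleP; last exact: orbit_escape_null.
exact: measurable_orbit_escape.
Qed.

(** Each letter of the itinerary reveals one letter of v: [T_shifts_Iword]
    transfers the statement for T x and v to the statement for x and a v. *)
Lemma itineraryE v x : Iunit x -> ~ exceptional x ->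
  itinerary v x <-> Iword pi v x.
Proof.
elim: v x => [|a v ih] x x1 Nx; first by rewrite itinerary_nil Iword_nil.
have [b [c [cc Ibx]]] : exists b c, contexts tree c /\ I (fi_cons b c) x.
  apply: regularP; apply: contrapT => Nreg; apply: Nx.
  by exists 0%N.
have NTx : ~ exceptional (T x).
  by move=> [n _ Tx]; apply: Nx; exists n.+1.
have xb : Iword pi [:: b] x.
  apply: Ifi_sub (interior_subset Ibx); apply: fi_word_prefix_cons.
  by case: (c) => // u; exact: prefix0s.
rewrite itinerary_cons; split.
  move=> [xa [_ /(ih _ (T_unit x1) NTx)]].
  have -> : a = b by rewrite -(rho_coding xa) (rho_coding xb).
  by move/(T_shifts_Iword v cc Ibx).
move=> xav; have xa : Iword pi [:: a] x := @Iword_cat_sub _ _ [:: a] v _ xav.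
split=> //; split=> //; apply/(ih _ (T_unit x1) NTx)/(T_shifts_Iword v cc Ibx).
by rewrite -(rho_coding xb) (rho_coding xa).
Qed.

Lemma lebesgue_measure_itinerary v :
  lebesgue_measure (itinerary v) = pi (starts_with v).
Proof.
rewrite -lebesgue_measure_Iword.
rewrite (measure_setD_null (mu := lebesgue_measure)
  measurable_exceptional exceptional_null
  (measurable_itinerary v)).
rewrite [RHS](measure_setD_null (mu := lebesgue_measure)
  measurable_exceptional exceptional_null
  (measurable_Iword pi v)).
congr (lebesgue_measure _); apply/seteqP; split=> x [xv Nx]; split=> //.
  by apply/itineraryE => //; exact: itinerary_sub01 xv.
by apply/itineraryE => //; exact: Iword_sub01 xv.
Qed.

End coding.
End mapping.

Lemma uniform_probE (R : realType) (B : set R) : measurable B ->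
  B `<=` `[0, 1] -> uniform_prob (@ltr01 R) B = lebesgue_measure B.
Proof.
move=> mB B1; rewrite /uniform_prob.
transitivity (\int[lebesgue_measure]_(x in B) 1%:E)%E.
  apply: eq_integral => x; rewrite inE => /B1 /=; rewrite in_itv/= => x01.
  by rewrite /uniform_pdf x01 subr0 invr1.
by rewrite integral_cst// mul1e.
Qed.

(** * Final letters of the chain *)

Section chain.
Variables (R : realType) (tree : set word) (q : fi_word -> probability bool R).
Variables (pi : probability left_space R) (d : measure_display).
Variables (Omega : measurableType d) (P : probability Omega R).
Variable (U : nat -> {RV P >-> left_space}).
Hypothesis tree_context : context_tree tree.
Hypothesis U_svlmc : svlmc tree q pi U.

Lemma measurable_transition a :
  measurable_fun setT (fun s : left_space => q (pref tree s) [set a]).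
Proof.
move=> _ Y mY; rewrite setTI.
rewrite (_ : _ @^-1` Y = \bigcup_n layer tree_context (fun c =>
    if `[< Y (q c [set a]) >] then starts_with_fi c else set0) n).
  apply: bigcupT_measurable => n; apply: measurable_layer => c.
  by case: ifP => // _; exact: measurable_starts_with_fi.
apply/seteqP; split=> s /=.
  have [c cc sc] := exists_context tree_context s.
  rewrite (pref_eq tree_context cc sc) => Yc.
  exists (rank tree_context c) => //; exists c => //=.
  by rewrite ifT//; exact/asboolP.
move=> [n _ [c [cc _]]]; case: ifP => // /asboolP Yc sc.
by rewrite (pref_eq tree_context cc sc).
Qed.

Definition appends n a : set Omega :=
  [set o | U n.+1 o = append_letter (U n o) a].

Lemma measurable_U n (A : set left_space) : measurable A -> measurable (U n @^-1` A).
Proof. by move=> mA; rewrite -[X in measurable X]setTI; exact: measurable_funPT. Qed.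

(** Equality of two random sequences is the conjunction of the equalities of
    their finite suffixes. *)
Lemma measurable_appends n a : measurable (appends n a).
Proof.
rewrite (_ : appends n a = \bigcap_k \bigcup_(w in [set: k.-tuple bool])
    (U n.+1 @^-1` starts_with (a :: w) `&` U n @^-1` starts_with w)).
  apply: bigcapT_measurable => k; apply: fin_bigcup_measurable => // w _.
  by apply: measurableI; apply: measurable_U; exact: measurable_starts_with.
apply/seteqP; split=> o.
  move=> /= Uo k _; exists (Tuple (introT eqP (size_past (U n o) k))) => //.
  by rewrite /starts_with/= size_past Uo past_append.
move=> h; apply: past_inj => -[|k] //; rewrite past_append.
have [w _ []] := h k I; rewrite /starts_with/= size_tuple => -> ->.
by [].
Qed.

Lemma appends_disj n : appends n false `&` appends n true = set0.
Proof.
rewrite -subset0 => o [U0 U1].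
by have /(congr1 (fun s : left_seq => s 0%N)) := etrans (esym U0) U1.
Qed.

(** The definition of the chain conditions on the whole past, of which the event
    that U_n lies in D is a part; the integral is then transported from Omega
    to the law of U_n. *)
Lemma transition_integral n a (D : set left_space) :
  (forall A, measurable A -> P (U n @^-1` A) = pi A) -> measurable D ->
  P (appends n a `&` U n @^-1` D) = (\int[pi]_(s in D) q (pref tree s) [set a])%E.
Proof.
move=> Un mD; case: U_svlmc => /(_ n a)[_ cond] _ _.
rewrite /appends cond; last first.
  apply: sub_sigma_algebra; exists n => //=.
  by exists D => //; rewrite setTI.
transitivity (\int[distribution P (U n)]_(s in D) q (pref tree s) [set a])%E.
  rewrite ge0_integral_pushforward//.
  exact: measurable_funTS (measurable_transition a).
by apply: eq_measure_integral => A mA _; exact: Un.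
Qed.

(** The stationarity equation, with the two terms of the kernel separated. *)
Lemma kernel_integral (A : set left_space) : measurable A ->
  (\int[pi]_(s in (fun s => append_letter s false : left_space) @^-1` A)
     q (pref tree s) [set false] +
   \int[pi]_(s in (fun s => append_letter s true : left_space) @^-1` A)
     q (pref tree s) [set true])%E = pi A.
Proof.
move=> mA; case: U_svlmc => _ st _; rewrite -st//.
have mD a : measurable ((fun s => append_letter s a : left_space) @^-1` A).
  by rewrite -[X in measurable X]setTI; exact: measurable_append_letter.
rewrite integral_mkcond [X in (_ + X)%E]integral_mkcond -ge0_integralD//.
- apply: eq_integral => s _; rewrite /vlmc_kernel !patchE big_bool/= addeC.
  have memE b : (s \in (fun s => append_letter s b : left_space) @^-1` A) =
      (append_letter s b \in A) by apply/idP/idP; rewrite !inE.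
  by rewrite !diracE !memE; case: (_ \in A); case: (_ \in A); rewrite ?mule1 ?mule0.
- by move=> s _; rewrite patchE; case: ifP.
- apply: (measurable_restrictT _ (mD _)).1; apply: measurable_funTS.
  exact: measurable_transition.
- by move=> s _; rewrite patchE; case: ifP.
- apply: (measurable_restrictT _ (mD _)).1; apply: measurable_funTS.
  exact: measurable_transition.
Qed.

Definition steps n : set Omega := appends n false `|` appends n true.

Lemma measurable_steps n : measurable (steps n).
Proof. by apply: measurableU; exact: measurable_appends. Qed.

(** Appending a letter according to the transition probabilities preserves pi;
    for the set of all sequences this says that U_(n+1) is almost surely U_n
    with a letter appended. *)
Lemma prob_steps n (A : set left_space) :
  (forall A, measurable A -> P (U n @^-1` A) = pi A) -> measurable A ->
  P (steps n `&` U n.+1 @^-1` A) = pi A.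
Proof.
move=> Un mA.
have mD a : measurable ((fun s => append_letter s a : left_space) @^-1` A).
  by rewrite -[X in measurable X]setTI; exact: measurable_append_letter.
rewrite -[RHS]kernel_integral// -!(transition_integral _ Un)// -measureU.
- congr (P _); apply/seteqP; split=> o; rewrite /steps /appends /preimage/=.
    by move=> [[] -> As]; [left|right].
  by move=> [] [E As]; rewrite E; split=> //; [left|right].
- by apply: measurableI; [exact: measurable_appends|exact: measurable_U].
- by apply: measurableI; [exact: measurable_appends|exact: measurable_U].
- by rewrite setIACA appends_disj set0I.
Qed.

Lemma misstep_null n :
  (forall A, measurable A -> P (U n @^-1` A) = pi A) -> P (~` steps n) = 0%E.
Proof.
move=> Un; rewrite probability_setC; last exact: measurable_steps.
have := prob_steps Un measurableT; rewrite preimage_setT setIT probability_setT => ->.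
by rewrite subee.
Qed.

Lemma U_distribution n (A : set left_space) :
  measurable A -> P (U n @^-1` A) = pi A.
Proof.
elim: n A => [|n ih] A mA; first by case: U_svlmc => _ _ /(_ A mA).
rewrite (measure_setD_null (N := ~` steps n)).
- by rewrite setDE setCK setIC; exact: prob_steps.
- by apply: measurableC; exact: measurable_steps.
- exact: misstep_null.
- exact: measurable_U.
Qed.

(** Only almost every trajectory extends U_n by one letter at every step; the
    others are collected here. *)
Definition missteps : set Omega := \bigcup_n ~` steps n.

Lemma measurable_missteps : measurable missteps.
Proof.
by apply: bigcupT_measurable => n; apply: measurableC; exact: measurable_steps.
Qed.

Lemma missteps_null : P missteps = 0%E.
Proof.
apply: measure_negligible; first exact: measurable_missteps.
apply: negligible_bigcup => n; apply/negligibleP.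
  by apply: measurableC; exact: measurable_steps.
apply: misstep_null => A; exact: U_distribution.
Qed.

Lemma past_final_letters o n : ~ missteps o ->
  past (U n o) n.+1 = rev (mkseq (fun k => final_letter U k o) n.+1).
Proof.
move=> No; elim: n => [|n ih]; first by rewrite past_shift.
have [a Ua] : exists a, U n.+1 o = append_letter (U n o) a.
  have : steps n o by apply: contrapT => Ns; apply: No; exists n.
  by case=> ?; [exists false|exists true].
by rewrite mkseqS rev_rcons -ih [in LHS]Ua past_append /final_letter Ua.
Qed.

Lemma final_letters_measurable N (w : word) :
  measurable [set o | mkseq (fun n => final_letter U n o) N = w].
Proof.
have [wN|wN] := eqVneq (size w) N; last first.
  rewrite (_ : [set _ | _] = set0)//; rewrite -subset0 => o /= ow.
  by move: wN; rewrite -ow size_mkseq eqxx.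
rewrite (_ : [set _ | _] = \bigcap_(n in [set n | (n < N)%N])
    U n @^-1` [set s | (s : left_seq) 0%N = nth false w n]).
  apply: bigcap_measurableType => n _; apply: measurable_U.
  exact: measurable_first_letter.
apply/seteqP; split=> o /=.
  by move=> <- n /= nN; rewrite nth_mkseq.
move=> h; apply: (@eq_from_nth _ false); rewrite size_mkseq// => n nN.
by rewrite nth_mkseq//; exact: h.
Qed.

(** Off a null set the N + 1 final letters, in reverse order, are the first
    letters of the reversal of U_N, and U_N has law pi. *)
Lemma final_letters_prob N (w : word) : size w = N.+1 ->
  P [set o | mkseq (fun n => final_letter U n o) N.+1 = w] =
  pi (starts_with (rev w)).
Proof.
move=> wN; have ms := measurable_starts_with (rev w).
rewrite -(U_distribution N ms).
rewrite (measure_setD_null measurable_missteps missteps_null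
  (final_letters_measurable _ _)).
rewrite [RHS](measure_setD_null measurable_missteps missteps_null (measurable_U N ms)).
congr (P _); apply/seteqP; split=> o [/= ow No]; split=> //; move: ow;
  rewrite /starts_with/= size_rev wN past_final_letters//.
  by move=> ->.
exact: (can_inj revK).
Qed.

End chain.

(** * Symmetry of the two processes *)

Theorem theorem22 (R : realType) (tree : set word)
    (q : fi_word -> probability bool R) (pi : probability left_space R)
    (d : measure_display) (Omega : measurableType d)
    (P : probability Omega R) (U : nat -> {RV P >-> left_space})
    (T : R -> R) (rho : R -> bool) :
  context_tree tree ->
  svlmc tree q pi U ->
  vlmc_mapping pi tree T ->
  coding_function pi rho ->
  (forall B : set R, measurable B -> B `<=` `[0, 1] ->
     measurable (`[0, 1] `&` T @^-1` B) /\
     lebesgue_measure (`[0, 1] `&` T @^-1` B) = lebesgue_measure B) /\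
  (forall (d' : measure_display) (Omega' : measurableType d')
      (P' : probability Omega' R) (xi : {RV P' >-> R}),
     (forall o : Omega', xi o \in `[0, 1]) ->
     (forall B : set R, measurable B ->
        distribution P' xi B = uniform_prob (@ltr01 R) B) ->
     forall (N : nat) (w : N.+1.-tuple bool),
       P [set o | mkseq (fun n => final_letter U n o) N.+1 = w] =
       P' [set o | mkseq (fun n => rho (iter n T (xi o))) N.+1 = rev w]).
Proof.
move=> tree_context U_svlmc T_mapping rho_coding.
have pi_stationary : stationary tree q pi by case: U_svlmc.
split=> [B mB B01|d' Omega' P' xi xi01 xi_unif N w].
  split; first exact: (measurable_preimage_T T_mapping).
  exact: (T_preserves_lebesgue tree_context pi_stationary T_mapping).
rewrite (final_letters_prob tree_context U_svlmc) ?size_tuple//.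
rewrite -(lebesgue_measure_itinerary tree_context pi_stationary T_mapping rho_coding).
have mI := measurable_itinerary T_mapping rho_coding (rev w).
rewrite -(uniform_probE mI); last exact: itinerary_sub01.
rewrite -xi_unif//.
congr (P' _); apply/seteqP; split=> o; rewrite /itinerary/= size_rev size_tuple.
  by case.
by split=> //; have := xi01 o; rewrite inE.
Qed.
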